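(* For all $n\geq 1$, $$B_{n}^{neobc}=\frac{6s_{2n-1}+3t_{2n-1}+3}{2},\quad C_{n}^{neobc}=6s_{2n-1}+6t_{2n-1}+3,$$ $$R_{n}^{neobc}=\frac{3t_{2n-1}-1}{2},\quad CR_{n}^{neobc}=3s_{2n-1}.$$
   Context: Let $\alpha=1+\sqrt2$, $\beta=1-\sqrt2$. The square triangular numbers are $S_k=s_k^2=\frac{t_k(t_k+1)}{2}$, where $s_k=\frac{\alpha^{2k}-\beta^{2k}}{4\sqrt2}$ and $t_k=\frac{\alpha^{2k}+\beta^{2k}-2}{4}$ ($k\ge1$) are the sides of the corresponding square and triangle. A positive integer $m$ is a neo balcobalancing number if there is a positive integer $r$ (its neo balcobalancer) such that $(1+2+\cdots+(m-1))+(1+2+\cdots+m)=2[(m-1)+m+(m+1)+(m+2)+\cdots+(m+r)]$; then $r=\frac{-2m-1+\sqrt{8m^2-12m+9}}{2}$. $B_n^{neobc}$ denotes the $n$-th neo balcobalancing number in increasing order ($n\ge1$), $R_n^{neobc}$ its neo balcobalancer, $C_n^{neobc}=\sqrt{8(B_n^{neobc})^2-12B_n^{neobc}+9}$ and $CR_n^{neobc}=\sqrt{2(R_n^{neobc})^2+5R_n^{neobc}+2}$. *)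

(* Defs.v *)
From mathcomp Require Import all_boot all_order all_algebra.
From mathcomp Require Import zify.
From mathcomp Require Import boolp classical_sets reals.

Set Implicit Arguments.
Unset Strict Implicit.
Unset Printing Implicit Defensive.

Import Order.TTheory GRing.Theory Num.Theory.

Section SquareTriangular.
Local Open Scope ring_scope.
Variable R : realType.

Definition alpha : R := 1 + Num.sqrt 2.
Definition beta : R := 1 - Num.sqrt 2.

Definition s (k : nat) : R :=
  (alpha ^+ (2 * k) - beta ^+ (2 * k)) / (4 * Num.sqrt 2).
Definition t (k : nat) : R :=
  (alpha ^+ (2 * k) + beta ^+ (2 * k) - 2) / 4.

End SquareTriangular.

Definition is_neobalcobalancer (m r : nat) : Prop :=
  0 < r /\
  \sum_(1 <= i < m) i + \sum_(1 <= i < m.+1) i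
    = 2 * \sum_(m.-1 <= i < (m + r).+1) i.

Definition neobalcobalancing (m : nat) : Prop :=
  0 < m /\ exists r, is_neobalcobalancer m r.

Lemma is_neobalcobalancerE (m r : nat) : 0 < m ->
  is_neobalcobalancer m r <->
  0 < r /\ m * m = (r + 2) * (2 * m + r - 1).
Proof.
case: m => // m _; rewrite /is_neobalcobalancer /=.
have gauss k : 2 * \sum_(1 <= i < k.+1) i = k * k.+1.
  elim: k => [|k IH]; first by rewrite big_geq.
  by rewrite big_nat_recr //= mulnDr IH; lia.
have -> : 2 * \sum_(m <= i < (m.+1 + r).+1) i = (r + 2) * (2 * m.+1 + r - 1).
  elim: r => [|r IH].
    by rewrite addn0 !big_nat_recr ?big_geq //=; lia.
  by rewrite addnS big_nat_recr ?mulnDr ?IH //=; lia.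
have -> : \sum_(1 <= i < m.+1) i + \sum_(1 <= i < m.+2) i = m.+1 * m.+1.
  by have := gauss m; have := gauss m.+1; lia.
by [].
Qed.

Lemma neobalcobalancing_unbounded (k : nat) :
  exists m, (k < m) && `[< neobalcobalancing m >].
Proof.
suff [m [km neo_m]] : exists m, k < m /\ neobalcobalancing m.
  by exists m; rewrite km; apply/asboolP.
elim: k => [|k [m [km [m0 [r /(is_neobalcobalancerE _ m0) [r0 e]]]]]].
  by exists 6; split=> //; split=> //; exists 1; apply/is_neobalcobalancerE.
case: m m0 km e => // m _ km e; case: r r0 e => // r _ e.
exists (29 * m + 12 * r + 35); split; first by lia.
split; first by lia.
exists (12 * m + 5 * r + 13); apply/is_neobalcobalancerE; first by lia.
split; first by lia.
have -> : 2 * (29 * m + 12 * r + 35) + (12 * m + 5 * r + 13) - 1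
  = 70 * m + 29 * r + 82 by lia.
have {}e : m.+1 * m.+1 = (r + 3) * (2 * m + r + 2) by rewrite e; congr (_ * _); lia.
by lia.
Qed.

(* The value at 0 is a dummy (0 is not a neo balcobalancing number): neobcB n.+1
   is the least neo balcobalancing number exceeding neobcB n, so that neobcB
   enumerates them increasingly from neobcB 1, the least of them. *)
Fixpoint neobcB (n : nat) : nat :=
  if n is n'.+1 then ex_minn (neobalcobalancing_unbounded (neobcB n')) else 0.

(* The neo balcobalancer of m is unique when m is neo balcobalancing; otherwise
   xget returns the default 0. *)
Definition neobalcobalancer (m : nat) : nat :=
  xget 0 [set r | is_neobalcobalancer m r]%classic.

Definition neobcR (n : nat) : nat := neobalcobalancer (neobcB n).

Section Companions.
Local Open Scope ring_scope.
Variable R : realType.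

Definition neobcC (n : nat) : R :=
  Num.sqrt (8 * (neobcB n)%:R ^+ 2 - 12 * (neobcB n)%:R + 9).

Definition neobcCR (n : nat) : R :=
  Num.sqrt (2 * (neobcR n)%:R ^+ 2 + 5 * (neobcR n)%:R + 2).

End Companions.

(* Main.v *)
(** Put [u = m - r - 2].  The defining equation of a neo balcobalancing number
    [m] with balancer [r] becomes the Pell-type equation
    [u ^ 2 = (r + 2) (2 r + 1)].  Multiplication by the unit
    [17 + 12 sqrt 2 = alpha ^ 4] acts on its solutions by
    [(u, r) |-> (17 u + 24 r + 30, 12 u + 17 r + 20)], and descent along the
    inverse map leads every solution with [r > 0] to [(3, 1)].  Hence the
    solutions form a single strictly increasing orbit, along which [u = 3 s] and
    [2 r + 1 = 3 t] at the odd indices. *)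
Require Import Defs.
From mathcomp Require Import all_boot all_order all_algebra.
From mathcomp Require Import zify ring lra.
From mathcomp Require Import boolp classical_sets reals.

Import Order.TTheory GRing.Theory Num.Theory.

Lemma is_neobalcobalancerP (m r : nat) : 0 < m ->
  is_neobalcobalancer m r <->
  exists u, [/\ 0 < r, m = u + r + 2 & u * u = (r + 2) * (2 * r + 1)].
Proof.
move=> m0; split.
- move=> /(is_neobalcobalancerE _ m0) [r0 e]; exists (m - (r + 2)).
  (* If [m < r + 2], the right side of [e] would exceed [m * m]; hence the truncated subtraction is
     exact. *)
  have lt_rm : r + 2 <= m by nia.
  have [u em] : exists u, m = u + r + 2 by exists (m - (r + 2)); lia.
  have -> : m - (r + 2) = u by lia.
  split=> //; move: e; rewrite em.
  have -> : 2 * (u + r + 2) + r - 1 = 2 * u + 3 * r + 3 by lia.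
  by lia.
- case=> u [r0 em e]; apply/(is_neobalcobalancerE _ m0); split=> //.
  rewrite em; have -> : 2 * (u + r + 2) + r - 1 = 2 * u + 3 * r + 3 by lia.
  by lia.
Qed.

(** With [x = 4 r + 5] the equation reads [x^2 - 8 u^2 = 9]. The map multiplies [x + 2 u sqrt 2] by
    the unit; the shift by 5 produces the constants 30 and 20. *)
Definition pell_step (p : nat * nat) : nat * nat :=
  (17 * p.1 + 24 * p.2 + 30, 12 * p.1 + 17 * p.2 + 20).

Definition pell_orbit (n : nat) : nat * nat := iter n pell_step (3, 1).

Lemma pell_orbit_gt0 (n : nat) : 0 < (pell_orbit n).2.
Proof. by case: n => //= n; lia. Qed.

Lemma pell_orbitP (n : nat) :
  (pell_orbit n).1 * (pell_orbit n).1 =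
  ((pell_orbit n).2 + 2) * (2 * (pell_orbit n).2 + 1).
Proof.
elim: n => //= n; rewrite -/(pell_orbit n).
by case: (pell_orbit n) => u r /=; lia.
Qed.

Lemma pell_descent (u r : nat) : 0 < r -> u * u = (r + 2) * (2 * r + 1) ->
  (u, r) = (3, 1) \/
  exists v q, [/\ 0 < q, v * v = (q + 2) * (2 * q + 1), q < r &
                  (u, r) = pell_step (v, q)].
Proof.
move=> r0 e.
(* [lo] and [hi] make the preimage satisfy [m >= 0] and [r >= -1], so that [w] and [q] below exist
   as naturals. Squaring [lo] gives [(r - 1) (r + 14) >= 0]. *)
have lo : 7 * r + 8 <= 5 * u by nia.
have hi : 12 * u <= 17 * r + 21 by nia.
have hi2 : 4 * u < 8 * r + 10 by nia.
have [w ew] : exists w, 5 * u = 7 * r + 8 + w by exists (5 * u - (7 * r + 8)); lia.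
have [q eq] : exists q, 12 * u + q = 17 * r + 21
  by exists (17 * r + 21 - 12 * u); lia.
have eu : u + 11 = 17 * w + 7 * q by lia.
have er : r + 9 = 12 * w + 5 * q by lia.
(* [w] and [q - 1] are the coordinates [m] and [r] of the preimage. *)
have ewq : w * w + 2 * (q + 1) = (q + 1) * (2 * w + q) by nia.
(* For [q = 0] and [q = 1], [ewq] becomes [w^2 - 2 w + 2 = 0] and [w^2 - 4 w + 2 = 0], which have no
   integer root. *)
case: q => [|[|q]] in eq eu er ewq *.
- by nia.
- have : w < 4 by nia.
  by case: w ewq {ew eu er} => [|[|[|[|w]]]] //; lia.
(* The preimage has first coordinate [v = w - (q + 3)]. If [v < 0], then [w >= 0] gives
   [(q + 3) (2 q + 3) = v^2 <= (q + 3)^2], so [q = 0], [v = -3], [w = 0]. *)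
have [ltwq|leqw] := ltnP w (q + 3).
  by left; have [-> ->] : u = 3 /\ r = 1 by nia.
right; exists (w - (q + 3)), q.+1.
have [v ev] : exists v, w = v + (q + 3) by exists (w - (q + 3)); lia.
rewrite ev addnK; rewrite {}ev in ew eu er ewq leqw.
by split=> //; [lia | lia | rewrite /pell_step /=; congr (_, _); lia].
Qed.

Lemma pell_orbit_complete (u r : nat) :
  0 < r -> u * u = (r + 2) * (2 * r + 1) -> exists n, (u, r) = pell_orbit n.
Proof.
have [k] := ubnP r; elim: k u r => // k IH u r rk r0 e.
case: (pell_descent _ _ r0 e) => [->|[v [q [q0 eqv ltqr ->]]]]; first by exists 0.
have [|n ->] := IH v q _ q0 eqv; first by lia.
by exists n.+1.
Qed.

Definition orbitB (n : nat) : nat := (pell_orbit n).1 + (pell_orbit n).2 + 2.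

Lemma orbitB_lt : {homo orbitB : i j / i < j}.
Proof.
apply: homo_ltn => [j i k|n]; first exact: ltn_trans.
by rewrite /orbitB /=; lia.
Qed.

Lemma orbitB_inj : injective orbitB.
Proof.
by move=> i j eqB; case: (ltngtP i j) => // /orbitB_lt; rewrite eqB ltnn.
Qed.

Lemma is_neobalcobalancer_orbit (m r : nat) : 0 < m ->
  is_neobalcobalancer m r <-> exists n, m = orbitB n /\ r = (pell_orbit n).2.
Proof.
move=> m0; rewrite is_neobalcobalancerP //; split.
- case=> u [r0 -> e]; have [n en] := pell_orbit_complete _ _ r0 e.
  by exists n; rewrite /orbitB -en.
- case=> n [-> ->]; exists (pell_orbit n).1.
  by split; [exact: pell_orbit_gt0 | | exact: pell_orbitP].
Qed.

Lemma neobalcobalancing_orbit (m : nat) :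
  neobalcobalancing m <-> exists n, m = orbitB n.
Proof.
split=> [[m0 [r /(is_neobalcobalancer_orbit _ _ m0) [n [-> _]]]]|[n ->]].
  by exists n.
have B0 : 0 < orbitB n by rewrite /orbitB; lia.
by split=> //; exists (pell_orbit n).2; apply/is_neobalcobalancer_orbit => //; exists n.
Qed.

(** Since [orbitB] is increasing, minimality among values reduces to minimality among orbit
    indices. *)
Lemma ex_minn_orbit (k n : nat) :
  k < orbitB n -> (forall j, k < orbitB j -> n <= j) ->
  ex_minn (neobalcobalancing_unbounded k) = orbitB n.
Proof.
move=> ltk min_n; case: ex_minnP => m /andP[ltkm /asboolP].
move=> /neobalcobalancing_orbit [j em] min_m; apply/eqP.
rewrite eqn_leq min_m /=; last first.
  by rewrite ltk; apply/asboolP/neobalcobalancing_orbit; exists n.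
rewrite em in ltkm *.
by have := min_n j ltkm; rewrite leq_eqVlt => /orP[/eqP ->|/orbitB_lt /ltnW].
Qed.

Lemma neobcBE (n : nat) : neobcB n.+1 = orbitB n.
Proof.
elim: n => [|n IH]; first by apply: ex_minn_orbit.
rewrite -[LHS]/(ex_minn (neobalcobalancing_unbounded (neobcB n.+1))) IH.
apply: ex_minn_orbit => [|j]; first exact: orbitB_lt.
by apply: contraTT; rewrite -!leqNgt leq_eqVlt => /orP[/eqP ->|/orbitB_lt /ltnW].
Qed.

Lemma neobcRE (n : nat) : neobcR n.+1 = (pell_orbit n).2.
Proof.
rewrite /neobcR neobcBE /neobalcobalancer.
have B0 : 0 < orbitB n by rewrite /orbitB; lia.
(* A balancer exists, so [xget] does not fall back on 0; injectivity of [orbitB] then identifies the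
   one it picks. *)
have : is_neobalcobalancer (orbitB n) (xget 0 [set r | is_neobalcobalancer (orbitB n) r]%classic).
  apply: (@xgetPex _ 0 [set r | is_neobalcobalancer (orbitB n) r]%classic).
  by exists (pell_orbit n).2; apply/is_neobalcobalancer_orbit => //; exists n.
by move=> /(is_neobalcobalancer_orbit _ _ B0) [k [/orbitB_inj <- ->]].
Qed.

Local Open Scope ring_scope.

Section Recurrences.
Variable R : realType.

Let sqr_sqrt2 : Num.sqrt (2 : R) ^+ 2 = 2.
Proof. by rewrite sqr_sqrtr. Qed.

Let sqrt2_neq0 : Num.sqrt (2 : R) != 0.
Proof. by rewrite sqrtr_eq0 -ltNge. Qed.

Lemma alphaX4 : alpha R ^+ 4 = 17 + 12 * Num.sqrt 2.
Proof. by have := sqr_sqrt2; rewrite /alpha => h; ring: h. Qed.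

Lemma betaX4 : beta R ^+ 4 = 17 - 12 * Num.sqrt 2.
Proof. by have := sqr_sqrt2; rewrite /beta => h; ring: h. Qed.

(** Raising the index by 2 multiplies the powers by [alpha ^+ 4] and [beta ^+ 4]; the constant 6
    comes from the [- 2] in [t]. *)
Lemma s_rec (k : nat) : s R k.+2 = 17 * s R k + 12 * t R k + 6.
Proof.
have -> : s R k.+2 =
    (alpha R ^+ (2 * k) * alpha R ^+ 4 - beta R ^+ (2 * k) * beta R ^+ 4) /
    (4 * Num.sqrt 2).
  by rewrite -!exprD /s (_ : 2 * k.+2 = 2 * k + 4)%N //; lia.
by rewrite alphaX4 betaX4 /s /t; field.
Qed.

Lemma t_rec (k : nat) : t R k.+2 = 24 * s R k + 17 * t R k + 8.
Proof.
have -> : t R k.+2 =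
    (alpha R ^+ (2 * k) * alpha R ^+ 4 + beta R ^+ (2 * k) * beta R ^+ 4 - 2) / 4.
  by rewrite -!exprD /t (_ : 2 * k.+2 = 2 * k + 4)%N //; lia.
by rewrite alphaX4 betaX4 /s /t; field: sqr_sqrt2.
Qed.

Lemma s1 : s R 1 = 1.
Proof. by rewrite /s /alpha /beta; field. Qed.

Lemma t1 : t R 1 = 1.
Proof. by rewrite /t /alpha /beta; field: sqr_sqrt2. Qed.

(** Under [u = 3 s], [r = (3 t - 1) / 2], the recurrences for [s] and [t] become [pell_step], and
    [s = t = 1] becomes [(3, 1)]. *)
Lemma pell_orbit_st (n : nat) :
  (pell_orbit n).1%:R = 3 * s R (2 * n).+1 /\
  (pell_orbit n).2%:R = (3 * t R (2 * n).+1 - 1) / 2.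
Proof.
elim: n => [|n [IHu IHr]]; first by rewrite /= s1 t1; split; field.
have -> : (2 * n.+1 = (2 * n).+2)%N by lia.
rewrite s_rec t_rec [pell_orbit n.+1]/(pell_step (pell_orbit n)).
by rewrite /pell_step !(natrD, natrM) IHu IHr; split; field.
Qed.

End Recurrences.

Theorem theorem6p2 (R : realType) (n : nat) (hn : (1 <= n)%N) :
  [/\ (neobcB n)%:R = (6 * s R (2 * n - 1) + 3 * t R (2 * n - 1) + 3) / 2,
      neobcC R n = 6 * s R (2 * n - 1) + 6 * t R (2 * n - 1) + 3,
      (neobcR n)%:R = (3 * t R (2 * n - 1) - 1) / 2
    & neobcCR R n = 3 * s R (2 * n - 1)].
Proof.
case: n hn => // n _.
have -> : (2 * n.+1 - 1 = (2 * n).+1)%N by lia.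
have [eu er] := pell_orbit_st R n.
have eS := f_equal (fun k => k%:R : R) (pell_orbitP n).
have u_ge0 : 0 <= (pell_orbit n).1%:R :> R by [].
have r_ge0 : 0 <= (pell_orbit n).2%:R :> R by [].
rewrite /neobcC /neobcCR neobcBE neobcRE /orbitB !natrD.
rewrite !(natrD, natrM) in eS.
have es : s R (2 * n).+1 = (pell_orbit n).1%:R / 3 by rewrite eu; field.
have et : t R (2 * n).+1 = (2 * (pell_orbit n).2%:R + 1) / 3 by rewrite er; field.
rewrite {}es {}et {eu er}.
move: (_ .1%:R) (_ .2%:R) => u r in eS u_ge0 r_ge0 *.
split.
- by field.
(* The root is [2 m + 2 r + 1], as in the closed formula for the balancer. *)
- have -> : 8 * (u + r + 2) ^+ 2 - 12 * (u + r + 2) + 9 = (2 * u + 4 * r + 5) ^+ 2.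
    by ring: eS.
  rewrite sqrtr_sqr ger0_norm; last by lra.
  by field.
- by field.
- have -> : 2 * r ^+ 2 + 5 * r + 2 = u ^+ 2 by ring: eS.
  by rewrite sqrtr_sqr ger0_norm //; field.
Qed.
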